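(* Let $t_0\geq 1$ and let $f:[t_0,+\infty)\times\mathbb{R}\to\mathbb{R}$ be a continuous function whose partial derivative $\frac{\partial f}{\partial t}(t,v)$ exists and is continuous in $[t_0,+\infty)\times\mathbb{R}$. Assume that $$v f(t,v)\geq 0,\qquad v\left[3f(t,v)+t\,\frac{\partial f}{\partial t}(t,v)\right]\leq 0$$ for all real numbers $t\geq t_0$ and $v\neq 0$. Then, if $x$ is a solution of the equation $$x''+f\left(t,\frac{x}{t}\right)=0,\qquad t\geq t_0,$$ $x$ is defined on $[t_0,+\infty)$ and either $x(t)=o(t)$ when $t\to+\infty$, or there exist $x_1,x_2\in\mathbb{R}$ with $x_1\neq 0$ such that $x(t)=x_1t+x_2+o(1)$ when $t\to+\infty$.
   Context: A solution of the equation means a $C^2$ real-valued function $x$ satisfying the equation on its maximal interval of existence to the right of $t_0$, i.e. on an interval $[t_0,T_\infty)$ with $t_0<T_\infty\leq+\infty$, such that $x$ cannot be extended as a solution beyond $T_\infty$. *)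

(* Defs.v *)
(* Stdlib reals with Coquelicot. *)
From Stdlib Require Import Reals.
From Coquelicot Require Import Coquelicot.
Open Scope R_scope.

(* Coquelicot's [is_derive g t l] with [locally t] restricted to [D]: at an
   endpoint of an interval [D] this is the one-sided derivative, and values of
   [g] outside [D] are irrelevant. *)
Definition is_derive_within (D : R -> Prop) (g : R -> R) (t l : R) : Prop :=
  filterdiff g (within D (locally t)) (fun h : R => scal h l).

(* The interval [t0, T), where T may be +oo. *)
Definition Ico (t0 : R) (T : Rbar) (t : R) : Prop :=
  t0 <= t /\ Rbar_lt t T.

(* x is C^2 on [t0, T) and x'' + f(t, x/t) = 0 there; x is a total function of
   which only the values on [t0, T) matter. *)
Definition solution_on (f : R -> R -> R) (t0 : R) (T : Rbar) (x : R -> R)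
  : Prop :=
  exists dx ddx : R -> R,
    (forall t : R, Ico t0 T t -> is_derive_within (Ico t0 T) x t (dx t)) /\
    (forall t : R, Ico t0 T t -> is_derive_within (Ico t0 T) dx t (ddx t)) /\
    continuous_on (Ico t0 T) ddx /\
    (forall t : R, Ico t0 T t -> ddx t + f t (x t / t) = 0).

Definition maximal_solution (f : R -> R -> R) (t0 : R) (T : Rbar) (x : R -> R)
  : Prop :=
  Rbar_lt t0 T /\
  solution_on f t0 T x /\
  ~ (exists (T' : Rbar) (y : R -> R),
       Rbar_lt T T' /\
       solution_on f t0 T' y /\
       (forall t : R, Ico t0 T t -> y t = x t)).

(* g(t) = o(h(t)) as t -> +oo; [is_domin] takes the dominating function first. *)
Definition little_o_pinfty (g h : R -> R) : Prop :=
  is_domin (Rbar_locally p_infty) h g.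

(* Main.v *)
Require Import Defs.
From Stdlib Require Import Reals Lra Lia ClassicalEpsilon.
From Coquelicot Require Import Coquelicot.
Open Scope R_scope.

(** In the variables [v = x / t] and [W = t ^ 2 * v' = t * x' - x] the equation
    becomes the first-order system [v' = W / t ^ 2], [W' = - t * f t v].  The
    hypothesis on [3 * f + t * ft] says that [t ^ 3 * f t v] moves towards [0]
    as [t] grows, for each fixed [v].  Hence the energy
    [W ^ 2 / 2 + int_0^v t ^ 3 * f t r dr] is nonincreasing along solutions
    ([energy_nonincreasing]); since [v * f t v >= 0] its second term is
    nonnegative, so [W] is bounded ([momentum_bounded]).

    Global existence.  If [T] were finite, the bound on [W] would make [v], and
    then [x'' = - f t v], [x'] and [x], converge as [t -> T].  As [f] is only
    continuous in [v], continuing [x] past [T] takes Peano's theorem: solutions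
    of equations with a delayed argument exist by iteration
    ([delayed_solution]), they are equi-Lipschitz, and a uniform limit point for
    vanishing delay solves the equation ([peano_bounded]).  Gluing the new
    solution to [x] ([solution_extends]) contradicts maximality.

    Asymptotics.  On [[t0, +oo)], [|v'| <= K / t ^ 2] gives [v -> L].  If
    [L = 0] then [x = o(t)].  If [L <> 0], then [v] eventually has the sign of
    [L], so [W' = - t * f t v] has a constant sign and the bounded function [W]
    converges to some [w] ([momentum_converges]).  Integrating
    [v' = W / t ^ 2] from [t] to infinity gives [t * (L - v t) -> w], that is,
    [x t = L * t - w + o(1)] ([affine_asymptote]). *)

(** * Preliminaries on real functions *)

Definition clamp (a b t : R) : R := Rmax a (Rmin b t).

Lemma clamp_bounds (a b t : R) : a <= b -> a <= clamp a b t <= b.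
Proof.
  intros Hab; unfold clamp; split; [apply Rmax_l |].
  apply Rmax_lub; [assumption | apply Rmin_l].
Qed.

Lemma clamp_id (a b t : R) : a <= t <= b -> clamp a b t = t.
Proof.
  intros Ht; unfold clamp.
  rewrite Rmin_right by lra; apply Rmax_right; lra.
Qed.

Lemma clamp_lipschitz (a b s t : R) :
  Rabs (clamp a b s - clamp a b t) <= Rabs (s - t).
Proof.
  unfold clamp, Rmax, Rmin.
  repeat destruct Rle_dec; apply Rabs_le_between;
    pose proof (Rle_abs (s - t)); pose proof (Rle_abs (- (s - t)));
    rewrite Rabs_Ropp in *; lra.
Qed.

Definition jointly_continuous (h : R -> R -> R) : Prop :=
  forall p : R * R, continuous (fun q : R * R => h (fst q) (snd q)) p.

Lemma jointly_continuous_comp (h : R -> R -> R) (u v : R -> R) (t : R) :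
  jointly_continuous h -> continuous u t -> continuous v t ->
  continuous (fun s => h (u s) (v s)) t.
Proof. intros Hh Hu Hv; exact (continuous_comp_2 u v h t Hu Hv (Hh _)). Qed.

Lemma filterlim_continuous_2 {A : Type} {F : (A -> Prop) -> Prop} {FF : Filter F}
  (u v : A -> R) (h : R -> R -> R) (a b : R) :
  filterlim u F (locally a) -> filterlim v F (locally b) ->
  continuous (fun q : R * R => h (fst q) (snd q)) (a, b) ->
  filterlim (fun s => h (u s) (v s)) F (locally (h a b)).
Proof.
  intros Hu Hv Hh; apply filterlim_locally; intros eps.
  destruct (proj2 (continuity_2d_pt_filterlim h a b) Hh eps) as [d Hd].
  generalize (filter_and _ _ (proj1 (filterlim_locally u a) Hu d)
                (proj1 (filterlim_locally v b) Hv d)).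
  apply filter_imp; intros s [Hs1 Hs2]; apply Hd; assumption.
Qed.

Lemma lipschitz_continuous (y : R -> R) (L : R) :
  (forall s t, Rabs (y s - y t) <= L * Rabs (s - t)) ->
  forall t, continuous y t.
Proof.
  intros HL t.
  apply filterlim_locally; intros eps.
  assert (HL0 : 0 <= L).
  { generalize (HL 1 0); generalize (Rabs_pos (y 1 - y 0)).
    rewrite Rminus_0_r, Rabs_R1; lra. }
  assert (Hd : 0 < eps / (L + 1)).
  { apply Rdiv_lt_0_compat; [apply cond_pos | lra]. }
  exists (mkposreal _ Hd); intros s Hs.
  change (Rabs (y s - y t) < eps); change (Rabs (s - t) < eps / (L + 1)) in Hs.
  apply Rle_lt_trans with (1 := HL s t).
  apply Rle_lt_trans with ((L + 1) * Rabs (s - t)).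
  - apply Rmult_le_compat_r; [apply Rabs_pos | lra].
  - apply (Rmult_lt_compat_l (L + 1)) in Hs; [| lra].
    replace ((L + 1) * (eps / (L + 1))) with (pos eps) in Hs by (field; lra).
    exact Hs.
Qed.

Lemma is_derive_continuous_at (y : R -> R) (t l : R) :
  is_derive y t l -> continuous y t.
Proof.
  intros H.
  exact (@ex_derive_continuous R_AbsRing R_NormedModule y t (ex_intro _ l H)).
Qed.

Lemma mean_value (g dg : R -> R) (a b : R) :
  a <= b -> (forall t, a <= t <= b -> is_derive g t (dg t)) ->
  exists c, a <= c <= b /\ g b - g a = dg c * (b - a).
Proof.
  intros Hab Hg.
  destruct (MVT_gen g a b dg) as [c Hc];
    rewrite ?Rmin_left, ?Rmax_right in * by assumption.
  - intros t Ht; apply Hg; lra.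
  - intros t Ht; apply continuity_pt_filterlim.
    exact (is_derive_continuous_at _ _ _ (Hg t Ht)).
  - exists c; exact Hc.
Qed.

Lemma continuous_ex_RInt (k : R -> R) (a b : R) :
  (forall t, continuous k t) -> ex_RInt k a b.
Proof. intros Hk; apply (@ex_RInt_continuous R_CompleteNormedModule); auto. Qed.

Lemma is_derive_primitive (k : R -> R) (c t : R) :
  (forall s, continuous k s) -> is_derive (fun s => RInt k c s) t (k t).
Proof.
  intros Hk; apply is_derive_RInt with c; [| apply Hk].
  apply filter_forall; intros s; apply RInt_correct, continuous_ex_RInt, Hk.
Qed.

(** * Uniform limit points of equi-Lipschitz sequences *)

Definition infinitely_many (A : nat -> Prop) : Prop :=
  forall N : nat, exists n : nat, (N <= n)%nat /\ A n.

Lemma bounded_sequence_thinning (u : nat -> R) (B : R) (A : nat -> Prop) :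
  (forall n, Rabs (u n) <= B) -> infinitely_many A ->
  forall eps, 0 < eps -> exists A' : nat -> Prop,
    infinitely_many A' /\ (forall n, A' n -> A n) /\
    forall n m, A' n -> A' m -> Rabs (u n - u m) <= eps.
Proof.
  intros Hu HA eps Heps.
  destruct (choice _ HA) as [phi Hphi].
  destruct (Bolzano_Weierstrass (fun N => u (phi N)) (fun c => - B <= c <= B))
    as [l Hl].
  { apply compact_P3. }
  { intros n; apply Rabs_le_between, Hu. }
  exists (fun n => A n /\ Rabs (u n - l) < eps / 2).
  split; [| split].
  - intros N.
    assert (Hpos : 0 < eps / 2) by lra.
    destruct (Hl (fun r => Rabs (r - l) < eps / 2) N) as [p [HNp Hp]].
    { exists (mkposreal _ Hpos); intros r Hr; exact Hr. }
    destruct (Hphi p) as [Hp1 Hp2].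
    exists (phi p); split; [lia | split; assumption].
  - intros n [Hn _]; exact Hn.
  - intros n m [_ Hn] [_ Hm].
    apply Rabs_def2 in Hn; apply Rabs_def2 in Hm.
    apply Rabs_le; lra.
Qed.

(** Finitely many sample points are handled one after the other, each time
    thinning the index set that serves the previous ones. *)
Lemma bounded_functions_thinning (u : nat -> R -> R) (B : R) (q : nat -> R)
  (N : nat) :
  (forall n t, Rabs (u n t) <= B) ->
  forall (A : nat -> Prop) (eps : R), infinitely_many A -> 0 < eps ->
  exists A' : nat -> Prop,
    infinitely_many A' /\ (forall n, A' n -> A n) /\
    forall i n m, (i < N)%nat -> A' n -> A' m ->
      Rabs (u n (q i) - u m (q i)) <= eps.
Proof.
  intros Hu A eps HA Heps; induction N as [| N [A1 [H1 [H2 H3]]]].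
  - exists A; split; [exact HA | split; [auto |]]; intros; lia.
  - destruct (bounded_sequence_thinning (fun n => u n (q N)) B A1
                (fun n => Hu n (q N)) H1 eps Heps) as [A2 [K1 [K2 K3]]].
    exists A2; split; [exact K1 | split; [auto |]].
    intros i n m Hi Hn Hm.
    destruct (Nat.eq_dec i N) as [-> | Hne]; [auto |].
    apply H3; auto; lia.
Qed.

(** The Lipschitz bound turns closeness on a finite grid into uniform
    closeness; the invariance under [clamp] makes a grid of [[a, b]] enough for
    the whole line. *)
Lemma lipschitz_thinning (u : nat -> R -> R) (a b B L : R) :
  a <= b ->
  (forall n t, Rabs (u n t) <= B) ->
  (forall n s t, Rabs (u n s - u n t) <= L * Rabs (s - t)) ->
  (forall n t, u n (clamp a b t) = u n t) ->
  forall (A : nat -> Prop) (eps : R), infinitely_many A -> 0 < eps ->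
  exists A' : nat -> Prop,
    infinitely_many A' /\ (forall n, A' n -> A n) /\
    forall n m t, A' n -> A' m -> Rabs (u n t - u m t) <= eps.
Proof.
  intros Hab HB HL Hclamp A eps HA Heps.
  assert (HL0 : 0 <= L).
  { generalize (HL 0%nat 1 0); generalize (Rabs_pos (u 0%nat 1 - u 0%nat 0)).
    rewrite Rminus_0_r, Rabs_R1; lra. }
  (* Mesh for which the variation within a cell is at most [eps / 3]; [L + 1]
     avoids dividing by zero. *)
  set (d := eps / (3 * (L + 1))).
  assert (Hd : 0 < d) by (apply Rdiv_lt_0_compat; lra).
  assert (HLd : L * d <= eps / 3).
  { unfold d. apply Rle_trans with ((L + 1) * (eps / (3 * (L + 1)))).
    - apply Rmult_le_compat_r; [apply Rlt_le, Hd | lra].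
    - right; field; lra. }
  destruct (nfloor_ex ((b - a) / d)) as [N HN].
  { apply Rdiv_le_0_compat; lra. }
  destruct (bounded_functions_thinning u B (fun i => a + INR i * d) (S N)
              HB A (eps / 3) HA ltac:(lra)) as [A' [H1 [H2 H3]]].
  exists A'; split; [exact H1 | split; [exact H2 |]].
  intros n m t Hn Hm.
  rewrite <- (Hclamp n t), <- (Hclamp m t).
  generalize (clamp_bounds a b t Hab); generalize (clamp a b t); clear t.
  intros t Ht.
  destruct (nfloor_ex ((t - a) / d)) as [i Hi].
  { apply Rdiv_le_0_compat; lra. }
  assert (HiN : (i < S N)%nat).
  { apply INR_lt; rewrite S_INR.
    apply Rle_lt_trans with ((t - a) / d); [lra |].
    apply Rle_lt_trans with ((b - a) / d); [| lra].
    apply Rmult_le_compat_r; [apply Rlt_le, Rinv_0_lt_compat, Hd | lra]. }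
  specialize (H3 i n m HiN Hn Hm); simpl in H3.
  assert (Hcell : Rabs (t - (a + INR i * d)) <= d).
  { assert (E : t - a = (t - a) / d * d) by (field; lra).
    destruct Hi as [Hi1 Hi2].
    apply (Rmult_le_compat_r d) in Hi1; [| lra].
    apply (Rmult_lt_compat_r d) in Hi2; [| lra].
    apply Rabs_le; lra. }
  assert (Hnear : forall k, Rabs (u k t - u k (a + INR i * d)) <= eps / 3).
  { intros k; eapply Rle_trans; [apply HL |].
    eapply Rle_trans; [| exact HLd].
    apply Rmult_le_compat_l; assumption. }
  generalize (Hnear n) (Hnear m); intros Hn' Hm'.
  apply Rabs_le_between in Hn'; apply Rabs_le_between in Hm'.
  apply Rabs_le_between in H3; apply Rabs_le; lra.
Qed.

(** A form of Ascoli's theorem in which a limit point replaces a convergent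
    subsequence.  Thinning again and again gives a decreasing chain of infinite
    index sets on which the oscillation of [u] tends to zero; [u] is Cauchy for
    the filter of the tails of these sets, in the complete space of functions
    with uniform distance. *)
Lemma ascoli_adherent (u : nat -> R -> R) (a b B L : R) :
  a <= b ->
  (forall n t, Rabs (u n t) <= B) ->
  (forall n s t, Rabs (u n s - u n t) <= L * Rabs (s - t)) ->
  (forall n t, u n (clamp a b t) = u n t) ->
  exists y : R -> R, forall (eps : R) (N : nat), 0 < eps ->
    exists n : nat, (N <= n)%nat /\ forall t, Rabs (u n t - y t) <= eps.
Proof.
  intros Hab HB HL Hclamp.
  pose proof (lipschitz_thinning u a b B L Hab HB HL Hclamp) as Hthin.
  set (inf_set := {A : nat -> Prop | infinitely_many A}).
  assert (Hstep : forall kA : nat * inf_set, exists A' : inf_set,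
    (forall n, proj1_sig A' n -> proj1_sig (snd kA) n) /\
    forall n m t, proj1_sig A' n -> proj1_sig A' m ->
      Rabs (u n t - u m t) <= / INR (S (fst kA))).
  { intros [k [A HA]].
    destruct (Hthin A (/ INR (S k)) HA) as [A' [H1 [H2 H3]]].
    { apply Rinv_0_lt_compat, lt_0_INR; lia. }
    exists (exist _ A' H1); split; assumption. }
  destruct (choice _ Hstep) as [next Hnext].
  assert (Htop : infinitely_many (fun _ => True)) by (intros N; exists N; auto).
  set (A := nat_rect (fun _ => inf_set) (exist _ _ Htop)
              (fun k Ak => next (k, Ak))).
  assert (Hdecr : forall k j n, proj1_sig (A (k + j)%nat) n -> proj1_sig (A k) n).
  { intros k j n; induction j as [| j IH].
    - rewrite Nat.add_0_r; auto.
    - rewrite Nat.add_succ_r; intros H; apply IH.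
      exact (proj1 (Hnext ((k + j)%nat, A (k + j)%nat)) n H). }
  (* Eventually along the chain [A], and for large indices. *)
  set (F := fun P : nat -> Prop =>
         exists k N, forall n, (N <= n)%nat -> proj1_sig (A k) n -> P n).
  assert (HF : ProperFilter F).
  { split; [| split].
    - intros P [k [N HP]].
      destruct (proj2_sig (A k) N) as [n [Hn1 Hn2]]; exists n; auto.
    - exists 0%nat, 0%nat; auto.
    - intros P Q [k [N HP]] [l [M HQ]].
      exists (k + l)%nat, (N + M)%nat; intros n Hn HA; split.
      + apply HP; [lia | exact (Hdecr k l n HA)].
      + apply HQ; [lia |]. rewrite Nat.add_comm in HA; exact (Hdecr l k n HA).
    - intros P Q HPQ [k [N HP]]; exists k, N; auto. }
  destruct (proj1 (@filterlim_locally_cauchy nat (@fct_CompleteSpace R R_CompleteSpace)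
                     F HF u)) as [y Hy].
  { intros eps.
    destruct (nfloor_ex (/ eps)) as [k Hk].
    { apply Rlt_le, Rinv_0_lt_compat, cond_pos. }
    assert (Hsmall : / INR (S k) < eps).
    { rewrite <- (Rinv_inv eps); apply Rinv_lt_contravar.
      - apply Rmult_lt_0_compat; [apply Rinv_0_lt_compat, cond_pos |].
        apply lt_0_INR; lia.
      - rewrite S_INR; lra. }
    exists (fun n => proj1_sig (A (S k)) n); split.
    - exists (S k), 0%nat; auto.
    - intros n m Hn Hm t.
      unfold ball; simpl; unfold AbsRing_ball, abs, minus, plus, opp; simpl.
      apply Rle_lt_trans with (2 := Hsmall).
      exact (proj2 (Hnext (k, A k)) m n t Hm Hn). }
  exists y; intros eps N Heps.
  destruct (proj1 (filterlim_locally (F := F) u y) Hy (mkposreal eps Heps))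
    as [k [M HM]].
  destruct (proj2_sig (A k) (N + M)%nat) as [n [Hn1 Hn2]].
  exists n; split; [lia |]; intros t.
  apply Rlt_le; apply (HM n ltac:(lia) Hn2 t).
Qed.

(** * Peano's theorem for second-order equations *)

Lemma RInt_close (k1 k2 : R -> R) (c t eps : R) :
  (forall s, continuous k1 s) -> (forall s, continuous k2 s) ->
  c <= t <= c + 1 ->
  (forall s, c <= s <= t -> Rabs (k1 s - k2 s) <= eps) ->
  Rabs (RInt k1 c t - RInt k2 c t) <= eps.
Proof.
  intros H1 H2 Ht Heps.
  change (RInt k1 c t - RInt k2 c t) with (minus (RInt k1 c t) (RInt k2 c t)).
  rewrite <- RInt_minus by (apply continuous_ex_RInt; assumption).
  apply Rle_trans with ((t - c) * eps).
  - apply abs_RInt_le_const; [lra | | exact Heps].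
    apply (@ex_RInt_continuous R_CompleteNormedModule); intros s _.
    apply @continuous_minus; [apply H1 | apply H2].
  - assert (0 <= eps).
    { eapply Rle_trans; [apply Rabs_pos | apply (Heps c); lra]. }
    assert ((t - c) * eps <= 1 * eps) by (apply Rmult_le_compat_r; lra). lra.
Qed.

(** The solution of [y'' = k] with [y c = a] and [y' c = p]. *)
Definition shoot (c a p : R) (k : R -> R) (t : R) : R :=
  a + RInt (fun s => p + RInt k c s) c t.

Lemma velocity_continuous (c p : R) (k : R -> R) :
  (forall s, continuous k s) ->
  forall t, continuous (fun s => p + RInt k c s) t.
Proof.
  intros Hk t; apply @continuous_plus; [apply continuous_const |].
  exact (is_derive_continuous_at _ _ _ (is_derive_primitive k c t Hk)).
Qed.

Lemma is_derive_velocity (c p : R) (k : R -> R) (t : R) :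
  (forall s, continuous k s) ->
  is_derive (fun s => p + RInt k c s) t (k t).
Proof.
  intros Hk; rewrite <- (Rplus_0_l (k t)).
  apply @is_derive_plus; [apply @is_derive_const |].
  apply is_derive_primitive, Hk.
Qed.

Lemma is_derive_shoot (c a p : R) (k : R -> R) (t : R) :
  (forall s, continuous k s) ->
  is_derive (shoot c a p k) t (p + RInt k c t).
Proof.
  intros Hk.
  replace (p + RInt k c t) with (0 + (p + RInt k c t)) by ring.
  apply @is_derive_plus; [apply @is_derive_const |].
  apply (is_derive_primitive (fun s => p + RInt k c s)), velocity_continuous, Hk.
Qed.

Lemma shoot_start (c a p : R) (k : R -> R) : shoot c a p k c = a.
Proof. unfold shoot; rewrite RInt_point; apply Rplus_0_r. Qed.

(** Two integrations over an interval of length at most [1] do not enlarge a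
    uniform error. *)
Lemma shoot_close (c a p : R) (k1 k2 : R -> R) (t eps : R) :
  (forall s, continuous k1 s) -> (forall s, continuous k2 s) ->
  c <= t <= c + 1 ->
  (forall s, c <= s <= t -> Rabs (k1 s - k2 s) <= eps) ->
  Rabs (shoot c a p k1 t - shoot c a p k2 t) <= eps.
Proof.
  intros H1 H2 Ht Heps; unfold shoot.
  match goal with |- Rabs (a + ?x - (a + ?y)) <= _ =>
    replace (a + x - (a + y)) with (x - y) by ring end.
  apply RInt_close; [apply velocity_continuous, H1 |
    apply velocity_continuous, H2 | exact Ht |].
  intros s Hs.
  match goal with |- Rabs (p + ?x - (p + ?y)) <= _ =>
    replace (p + x - (p + y)) with (x - y) by ring end.
  apply RInt_close; auto; [lra | intros r Hr; apply Heps; lra].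
Qed.

Lemma shoot_lipschitz (c a p M : R) (k : R -> R) (s t : R) :
  (forall r, continuous k r) -> (forall r, Rabs (k r) <= M) ->
  c <= s <= c + 1 -> c <= t <= c + 1 ->
  Rabs (shoot c a p k s - shoot c a p k t) <= (Rabs p + M) * Rabs (s - t).
Proof.
  intros Hk HM.
  assert (Hle : forall s t, c <= s -> s <= t -> t <= c + 1 ->
    Rabs (shoot c a p k s - shoot c a p k t) <= (Rabs p + M) * Rabs (s - t)).
  { clear s t; intros s t Hs Hst Ht.
    destruct (mean_value (shoot c a p k) (fun r => p + RInt k c r) s t Hst)
      as [r [Hr E]].
    { intros r _; apply is_derive_shoot, Hk. }
    rewrite Rabs_minus_sym, E, Rabs_mult, (Rabs_minus_sym s t).
    apply Rmult_le_compat_r; [apply Rabs_pos |].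
    apply Rle_trans with (1 := Rabs_triang _ _).
    apply Rplus_le_compat_l.
    apply Rle_trans with ((r - c) * M).
    - apply abs_RInt_le_const; [lra | apply continuous_ex_RInt, Hk | auto].
    - assert (0 <= M) by (apply Rle_trans with (2 := HM 0), Rabs_pos).
      assert ((r - c) * M <= 1 * M) by (apply Rmult_le_compat_r; lra). lra. }
  intros Hs Ht; destruct (Rle_dec s t) as [Hst | Hts].
  - apply Hle; lra.
  - rewrite Rabs_minus_sym, (Rabs_minus_sym s t); apply Hle; lra.
Qed.

(** A fixed point is a Tonelli approximation: it solves
    [y'' t = h t (y (t - eta))] on [[c, c + 1]], and the clamp makes it constant
    outside this interval. *)
Definition delayed_step (h : R -> R -> R) (c a p eta : R) (y : R -> R) (t : R)
  : R :=
  shoot c a p (fun s => h s (y (s - eta))) (clamp c (c + 1) t).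

Lemma delayed_continuous (h : R -> R -> R) (y : R -> R) (eta : R) :
  jointly_continuous h -> (forall t, continuous y t) ->
  forall t, continuous (fun s => h s (y (s - eta))) t.
Proof.
  intros Hh Hy t; apply (jointly_continuous_comp h (fun s => s)); [exact Hh | |].
  - apply continuous_id.
  - apply (continuous_comp (fun s => s - eta) y); [| apply Hy].
    apply @continuous_minus; [apply continuous_id | apply continuous_const].
Qed.

Lemma delayed_step_lipschitz (h : R -> R -> R) (c a p eta M : R) (y : R -> R) :
  jointly_continuous h -> (forall s v, Rabs (h s v) <= M) ->
  (forall t, continuous y t) ->
  forall s t, Rabs (delayed_step h c a p eta y s - delayed_step h c a p eta y t)
    <= (Rabs p + M) * Rabs (s - t).
Proof.
  intros Hh HM Hy s t; unfold delayed_step.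
  eapply Rle_trans; [apply (shoot_lipschitz _ _ _ M) |].
  - apply delayed_continuous; assumption.
  - intros r; apply HM.
  - apply clamp_bounds; lra.
  - apply clamp_bounds; lra.
  - apply Rmult_le_compat_l; [| apply clamp_lipschitz].
    apply Rplus_le_le_0_compat; [apply Rabs_pos |].
    apply Rle_trans with (2 := HM 0 0), Rabs_pos.
Qed.

(** The delay makes the equation explicit: the right-hand side at time [t] only
    reads [y] up to [t - eta].  So each iteration of [delayed_step] settles [y]
    on a further stretch of length [eta], and finitely many iterations reach
    the end of the interval, whatever the regularity of [h]. *)
Lemma delayed_solution (h : R -> R -> R) (c a p M eta : R) :
  jointly_continuous h -> (forall s v, Rabs (h s v) <= M) -> 0 < eta ->
  exists y : R -> R,
    (forall s t, Rabs (y s - y t) <= (Rabs p + M) * Rabs (s - t)) /\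
    forall t, y t = delayed_step h c a p eta y t.
Proof.
  intros Hh HM Heta.
  set (y := fun n => Nat.iter n (delayed_step h c a p eta) (fun _ => a)).
  assert (HM0 : 0 <= M) by (apply Rle_trans with (2 := HM 0 0), Rabs_pos).
  assert (HL : forall n s t,
    Rabs (y n s - y n t) <= (Rabs p + M) * Rabs (s - t)).
  { induction n as [| n IH]; intros s t.
    - simpl; rewrite Rminus_diag, Rabs_R0.
      apply Rmult_le_pos; [| apply Rabs_pos].
      apply Rplus_le_le_0_compat; [apply Rabs_pos | exact HM0].
    - apply delayed_step_lipschitz; auto.
      exact (lipschitz_continuous _ _ IH). }
  pose proof (fun n => lipschitz_continuous _ _ (HL n)) as Hcont.
  assert (Hstable : forall n t, t <= c + INR n * eta -> y (S n) t = y n t).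
  { induction n as [| n IH]; intros t Ht.
    - simpl in Ht |- *; unfold delayed_step.
      replace (clamp c (c + 1) t) with c; [apply shoot_start |].
      unfold clamp; rewrite Rmin_right by lra.
      symmetry; apply Rmax_left; lra.
    - rewrite S_INR in Ht.
      change (delayed_step h c a p eta (y (S n)) t
              = delayed_step h c a p eta (y n) t).
      unfold delayed_step.
      pose proof (clamp_bounds c (c + 1) t ltac:(lra)) as Hb.
      assert (Hct : clamp c (c + 1) t <= Rmax c t).
      { unfold clamp; apply Rle_max_compat_l, Rmin_r. }
      apply Rminus_diag_uniq; destruct (Req_dec
        (shoot c a p (fun s => h s (y (S n) (s - eta))) (clamp c (c + 1) t) -
         shoot c a p (fun s => h s (y n (s - eta))) (clamp c (c + 1) t)) 0)
        as [E | E]; [exact E | exfalso].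
      apply Rabs_pos_lt in E; apply Rlt_not_le in E; apply E.
      apply shoot_close; [apply delayed_continuous; auto |
        apply delayed_continuous; auto | exact Hb |].
      intros s Hs; rewrite IH, Rminus_diag, Rabs_R0; [lra |].
      assert (0 <= INR n * eta) by (apply Rmult_le_pos; [apply pos_INR | lra]).
      apply Rmax_Rle in Hct; destruct Hct as [Hct | Hct]; lra. }
  (* [N + 1] steps of length [eta] cover [[c, c + 1]]. *)
  destruct (nfloor_ex (/ eta)) as [N HN].
  { apply Rlt_le, Rinv_0_lt_compat, Heta. }
  assert (HNeta : 1 <= INR (S N) * eta).
  { rewrite S_INR.
    apply Rle_trans with (/ eta * eta); [right; field; lra |].
    apply Rmult_le_compat_r; lra. }
  exists (y (S N)); split; [apply HL |].
  intros t.
  assert (Eclamp : forall k, y (S k) t = y (S k) (clamp c (c + 1) t)).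
  { intros k; simpl; unfold delayed_step; f_equal.
    symmetry; apply clamp_id, clamp_bounds; lra. }
  rewrite Eclamp; rewrite <- Hstable; [symmetry; apply (Eclamp (S N)) |].
  pose proof (clamp_bounds c (c + 1) t ltac:(lra)); lra.
Qed.

(** The solutions with delay [1 / (n + 1)] are equi-Lipschitz, hence have a
    uniform limit point; uniform continuity of [h] on a compact rectangle lets
    the limit pass through [h], and the vanishing delay costs only the Lipschitz
    constant times the delay. *)
Lemma peano_bounded (h : R -> R -> R) (c a p M : R) :
  jointly_continuous h -> (forall s v, Rabs (h s v) <= M) ->
  exists y : R -> R, (forall t, continuous y t) /\
    forall t, c <= t <= c + 1 -> y t = shoot c a p (fun s => h s (y s)) t.
Proof.
  intros Hh HM.
  assert (HM0 : 0 <= M) by (apply Rle_trans with (2 := HM 0 0), Rabs_pos).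
  set (L := Rabs p + M).
  assert (HL0 : 0 <= L).
  { apply Rplus_le_le_0_compat; [apply Rabs_pos | exact HM0]. }
  set (eta := fun n => / INR (S n)).
  assert (Heta : forall n, 0 < eta n).
  { intros n; apply Rinv_0_lt_compat, lt_0_INR; lia. }
  destruct (choice (fun n y =>
      (forall s t, Rabs (y s - y t) <= L * Rabs (s - t)) /\
      forall t, y t = delayed_step h c a p (eta n) y t)
    (fun n => delayed_solution h c a p M (eta n) Hh HM (Heta n))) as [u Hu].
  assert (Huc : forall n t, continuous (u n) t).
  { intros n; exact (lipschitz_continuous _ _ (proj1 (Hu n))). }
  assert (Hclamp : forall n t, u n (clamp c (c + 1) t) = u n t).
  { intros n t; rewrite (proj2 (Hu n) t), (proj2 (Hu n) (clamp c (c + 1) t)).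
    unfold delayed_step; f_equal; apply clamp_id, clamp_bounds; lra. }
  assert (Hstart : forall n, u n c = a).
  { intros n; rewrite (proj2 (Hu n)); unfold delayed_step.
    rewrite clamp_id by lra; apply shoot_start. }
  assert (Hnear : forall n t, Rabs (u n t - a) <= L).
  { intros n t; rewrite <- (Hclamp n t), <- (Hstart n).
    eapply Rle_trans; [apply (proj1 (Hu n)) |].
    assert (Rabs (clamp c (c + 1) t - c) <= 1).
    { pose proof (clamp_bounds c (c + 1) t ltac:(lra)); apply Rabs_le; lra. }
    rewrite <- (Rmult_1_r L) at 2; apply Rmult_le_compat_l; assumption. }
  destruct (ascoli_adherent u c (c + 1) (Rabs a + L) L) as [y Hy];
    [lra | | intros n; apply (proj1 (Hu n)) | exact Hclamp |].
  { intros n t; replace (u n t) with (a + (u n t - a)) by ring.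
    eapply Rle_trans; [apply Rabs_triang |]; apply Rplus_le_compat_l, Hnear. }
  assert (Hylip : forall s t, Rabs (y s - y t) <= L * Rabs (s - t)).
  { intros s t; apply le_epsilon; intros eps Heps.
    destruct (Hy (eps / 2) 0%nat ltac:(lra)) as [n [_ Hn]].
    replace (y s - y t)
      with (- (u n s - y s) + ((u n s - u n t) + (u n t - y t))) by ring.
    eapply Rle_trans; [apply Rabs_triang |].
    rewrite Rabs_Ropp.
    pose proof (Rabs_triang (u n s - u n t) (u n t - y t)).
    pose proof (Hn s); pose proof (Hn t); pose proof (proj1 (Hu n) s t); lra. }
  pose proof (lipschitz_continuous _ _ Hylip) as Hyc.
  assert (Hynear : forall t, Rabs (y t - a) <= L).
  { intros t; apply le_epsilon; intros eps Heps.
    destruct (Hy eps 0%nat Heps) as [n [_ Hn]].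
    replace (y t - a) with (- (u n t - y t) + (u n t - a)) by ring.
    eapply Rle_trans; [apply Rabs_triang |]; rewrite Rabs_Ropp.
    pose proof (Hn t); pose proof (Hnear n t); lra. }
  exists y; split; [exact Hyc |].
  intros t Ht.
  apply Rminus_diag_uniq, Rabs_eq_0, Rle_antisym; [| apply Rabs_pos].
  apply le_epsilon; intros eps Heps; rewrite Rplus_0_l.
  destruct (uniform_continuity_2d h c (c + 1) (a - L) (a + L)) with
    (eps := mkposreal (eps / 2) ltac:(lra)) as [d Hd].
  { intros s v _ _; apply continuity_2d_pt_filterlim; apply (Hh (s, v)). }
  (* Half of the modulus [d] is spent on the distance from [u n] to [y], the
     other half on the displacement of [u n] during the delay. *)
  set (e := Rmin (eps / 2) (d / 2)).
  assert (Hd0 := cond_pos d).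
  assert (He : 0 < e) by (apply Rmin_pos; lra).
  destruct (nfloor_ex (2 * L / d)) as [N HN].
  { apply Rdiv_le_0_compat; lra. }
  destruct (Hy e N He) as [n [HnN Hn]].
  assert (Hdelay : L * eta n < d / 2).
  { assert (HSn : 2 * L / d < INR (S n)).
    { apply Rlt_le_trans with (INR N + 1); [lra |].
      rewrite S_INR; apply Rplus_le_compat_r, le_INR, HnN. }
    assert (HSn0 : 0 < INR (S n)) by (apply lt_0_INR; lia).
    unfold eta; apply Rmult_lt_reg_r with (INR (S n)); [exact HSn0 |].
    rewrite Rmult_assoc, Rinv_l by lra.
    apply (Rmult_lt_compat_l (d / 2)) in HSn; [| lra].
    replace (d / 2 * (2 * L / d)) with L in HSn by (field; lra). lra. }
  replace (y t - shoot c a p (fun s => h s (y s)) t)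
    with (- (u n t - y t) + (u n t - shoot c a p (fun s => h s (y s)) t))
    by ring.
  eapply Rle_trans; [apply Rabs_triang |]; rewrite Rabs_Ropp.
  replace eps with (eps / 2 + eps / 2) by lra; apply Rplus_le_compat.
  { apply Rle_trans with (1 := Hn t), Rmin_l. }
  rewrite (proj2 (Hu n) t); unfold delayed_step; rewrite clamp_id by exact Ht.
  apply shoot_close; [apply delayed_continuous; auto | | exact Ht |].
  { intros s; apply (jointly_continuous_comp h (fun s => s) y);
      [exact Hh | apply continuous_id | apply Hyc]. }
  intros s Hs; apply Rlt_le, Hd; try lra.
  - pose proof (Hynear s) as H; apply Rabs_le_between in H; lra.
  - pose proof (Hnear n (s - eta n)) as H; apply Rabs_le_between in H; lra.
  - rewrite Rminus_diag, Rabs_R0; exact Hd0.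
  - replace (u n (s - eta n) - y s)
      with ((u n (s - eta n) - u n s) + (u n s - y s)) by ring.
    eapply Rle_lt_trans; [apply Rabs_triang |].
    pose proof (proj1 (Hu n) (s - eta n) s) as H1.
    replace (s - eta n - s) with (- eta n) in H1 by ring.
    rewrite Rabs_Ropp, (Rabs_pos_eq (eta n)) in H1 by (apply Rlt_le, Heta).
    pose proof (Hn s); pose proof (Rmin_r (eps / 2) (d / 2)); fold e in H0.
    lra.
Qed.

(** Near [(c, a)] the field [h] is bounded by continuity.  Clamping both
    arguments to a small box makes it bounded and continuous everywhere; the
    solution of the clamped equation stays in the box for a short time, during
    which the clamps are inactive. *)
Lemma peano_local (h : R -> R -> R) (c a p : R) :
  (forall t v, c <= t ->
     continuous (fun q : R * R => h (fst q) (snd q)) (t, v)) ->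
  exists (d : R) (y dy : R -> R), 0 < d /\ y c = a /\ dy c = p /\
    (forall t, is_derive y t (dy t)) /\
    (forall t, c <= t < c + d -> is_derive dy t (h t (y t))).
Proof.
  intros Hh.
  destruct (proj2 (continuity_2d_pt_filterlim h c a) (Hh c a (Rle_refl c))
              (mkposreal 1 Rlt_0_1)) as [r Hr].
  simpl in Hr; assert (Hr0 := cond_pos r).
  set (t' := clamp c (c + r / 2)); set (v' := clamp (a - r / 2) (a + r / 2)).
  assert (Ht' : forall t, c <= t' t <= c + r / 2).
  { intros t; apply clamp_bounds; lra. }
  assert (Hv' : forall v, a - r / 2 <= v' v <= a + r / 2).
  { intros v; apply clamp_bounds; lra. }
  assert (Hclampc : forall b1 b2 t, continuous (clamp b1 b2) t).
  { intros b1 b2; apply lipschitz_continuous with 1.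
    intros s t; rewrite Rmult_1_l; apply clamp_lipschitz. }
  set (k := fun t v => h (t' t) (v' v)).
  assert (Hk : jointly_continuous k).
  { intros [t v]; unfold k.
    apply (continuous_comp_2 (fun q : R * R => t' (fst q))
             (fun q : R * R => v' (snd q)) h (t, v)).
    - exact (continuous_comp fst t' (t, v) (continuous_fst t v) (Hclampc _ _ _)).
    - exact (continuous_comp snd v' (t, v) (continuous_snd t v) (Hclampc _ _ _)).
    - apply Hh, Ht'. }
  destruct (peano_bounded k c a p (Rabs (h c a) + 1) Hk) as [y [Hyc Hy]].
  { intros t v; unfold k.
    replace (h (t' t) (v' v)) with (h c a + (h (t' t) (v' v) - h c a)) by ring.
    eapply Rle_trans; [apply Rabs_triang |]; apply Rplus_le_compat_l, Rlt_le.
    apply Hr; apply Rabs_def1; specialize (Ht' t); specialize (Hv' v); lra. }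
  assert (Hkc : forall s, continuous (fun r => k r (y r)) s).
  { intros s; apply (jointly_continuous_comp k (fun s => s) y);
      [exact Hk | apply continuous_id | apply Hyc]. }
  set (z := shoot c a p (fun s => k s (y s))).
  assert (Hz : forall t, is_derive z t (p + RInt (fun s => k s (y s)) c t)).
  { intros t; apply is_derive_shoot, Hkc. }
  destruct (proj1 (filterlim_locally z (z c))
              (is_derive_continuous_at _ _ _ (Hz c)) (mkposreal (r / 2) ltac:(lra)))
    as [d Hd].
  assert (Hd0 := cond_pos d).
  exists (Rmin d (Rmin 1 (r / 2))), z, (fun t => p + RInt (fun s => k s (y s)) c t).
  split; [repeat apply Rmin_pos; lra |].
  split; [apply shoot_start |].
  split; [rewrite RInt_point; apply Rplus_0_r |].
  split; [exact Hz |].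
  intros t Ht.
  assert (H1 := Rmin_l d (Rmin 1 (r / 2))).
  assert (H2 := Rmin_r d (Rmin 1 (r / 2))).
  assert (H3 := Rmin_l 1 (r / 2)); assert (H4 := Rmin_r 1 (r / 2)).
  assert (Ez : y t = z t) by (apply Hy; lra).
  assert (Hzt : Rabs (z t - z c) < r / 2).
  { apply (Hd t); change (Rabs (t - c) < d); apply Rabs_def1; lra. }
  replace (h t (z t)) with (k t (y t)).
  { exact (is_derive_velocity c p (fun s => k s (y s)) t Hkc). }
  unfold k, t', v'; rewrite !clamp_id; [rewrite Ez; reflexivity | | lra].
  rewrite Ez; unfold z in Hzt |- *; rewrite shoot_start in Hzt.
  apply Rabs_def2 in Hzt; lra.
Qed.

(** * Derivatives within an interval *)

(** The proof from right to left uses that [D t] makes [t] the only limit of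
    [within D (locally t)]. *)
Lemma is_derive_within_iff (D : R -> Prop) (g : R -> R) (t l : R) :
  D t ->
  (is_derive_within D g t l <->
   forall eps, 0 < eps -> exists d, 0 < d /\ forall s, D s -> Rabs (s - t) < d ->
     Rabs (g s - g t - (s - t) * l) <= eps * Rabs (s - t)).
Proof.
  intros Ht; split.
  - intros [_ H] eps Heps.
    destruct (H t) with (eps := mkposreal eps Heps) as [d Hd].
    { intros P HP; unfold within; apply filter_imp with (2 := HP); auto. }
    exists d; split; [apply cond_pos |].
    intros s Hs Hst; exact (Hd s Hst Hs).
  - intros H; split; [apply @is_linear_scal_l |].
    intros x Hx.
    assert (E : x = t).
    { apply Rminus_diag_uniq, Rabs_eq_0, Rle_antisym; [| apply Rabs_pos].
      apply le_epsilon; intros eps Heps; rewrite Rplus_0_l.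
      assert (Hball : within D (locally t) (ball x (mkposreal eps Heps))).
      { apply Hx; exists (mkposreal eps Heps); auto. }
      apply locally_singleton in Hball; specialize (Hball Ht).
      rewrite Rabs_minus_sym; apply Rlt_le; exact Hball. }
    subst x; intros eps.
    destruct (H eps (cond_pos eps)) as [d [Hd0 Hd]].
    exists (mkposreal d Hd0); intros s Hst Hs; exact (Hd s Hs Hst).
Qed.

Lemma is_derive_within_interior (D : R -> Prop) (g : R -> R) (t l : R) :
  locally t D -> is_derive_within D g t l -> is_derive g t l.
Proof.
  intros HD [Hlin H]; split; [exact Hlin |].
  intros x Hx eps.
  assert (Hx' : is_filter_lim (within D (locally t)) x).
  { intros P HP; unfold within; apply filter_imp with (2 := Hx P HP); auto. }
  generalize (filter_and _ _ HD (H x Hx' eps)).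
  apply filter_imp; intros s [Hs Hmin]; exact (Hmin Hs).
Qed.

Lemma is_derive_within_continuous (D : R -> Prop) (g : R -> R) (t l : R) :
  D t -> is_derive_within D g t l ->
  filterlim g (within D (locally t)) (locally (g t)).
Proof.
  intros Ht Hg; apply filterlim_locally; intros eps.
  destruct (proj1 (is_derive_within_iff D g t l Ht) Hg 1 Rlt_0_1)
    as [d [Hd0 Hd]].
  assert (Heps := cond_pos eps).
  set (K := Rabs l + 1).
  assert (HK : 0 < K) by (generalize (Rabs_pos l); unfold K; lra).
  assert (Hm : 0 < Rmin d (eps / K)).
  { apply Rmin_pos; [| apply Rdiv_lt_0_compat]; assumption. }
  exists (mkposreal _ Hm); intros s Hst Hs.
  change (Rabs (s - t) < Rmin d (eps / K)) in Hst.
  assert (H1 := Rmin_l d (eps / K)); assert (H2 := Rmin_r d (eps / K)).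
  specialize (Hd s Hs ltac:(lra)).
  change (Rabs (g s - g t) < eps).
  replace (g s - g t) with ((g s - g t - (s - t) * l) + (s - t) * l) by ring.
  eapply Rle_lt_trans; [apply Rabs_triang |].
  rewrite (Rabs_mult (s - t)).
  apply Rle_lt_trans with (K * Rabs (s - t)); [unfold K; lra |].
  replace (pos eps) with (K * (eps / K)) by (field; lra).
  apply Rmult_lt_compat_l; lra.
Qed.

Lemma is_derive_eps (g : R -> R) (t l : R) :
  is_derive g t l ->
  forall eps, 0 < eps -> exists d, 0 < d /\ forall s, Rabs (s - t) < d ->
    Rabs (g s - g t - (s - t) * l) <= eps * Rabs (s - t).
Proof.
  intros [_ H] eps Heps.
  destruct (H t (fun P HP => HP) (mkposreal eps Heps)) as [d Hd].
  exists d; split; [apply cond_pos | exact Hd].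
Qed.

Lemma Ico_interior (t0 : R) (T : Rbar) (t : R) :
  t0 < t -> Rbar_lt t T -> locally t (Ico t0 T).
Proof.
  intros H0 HT.
  assert (H1 : locally t (fun s => t0 < s)) by (apply open_gt; exact H0).
  assert (H2 : locally t (fun s => Rbar_lt s T)).
  { destruct T as [T | |]; simpl in HT |- *.
    - apply open_lt; exact HT.
    - apply filter_forall; auto.
    - contradiction. }
  generalize (filter_and _ _ H1 H2); apply filter_imp.
  intros s [Hs1 Hs2]; split; [apply Rlt_le |]; assumption.
Qed.

(** * Continuation of solutions *)

Lemma left_limit_eps (g : R -> R) (T l : R) :
  filterlim g (at_left T) (locally l) ->
  forall eps, 0 < eps -> exists d, 0 < d /\
    forall s, T - d < s < T -> Rabs (g s - l) < eps.
Proof.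
  intros H eps Heps.
  destruct (proj1 (filterlim_locally g l) H (mkposreal eps Heps)) as [d Hd].
  exists d; split; [apply cond_pos |].
  intros s Hs; apply (Hd s); [| lra].
  change (Rabs (s - T) < d); apply Rabs_def1; lra.
Qed.

Lemma lipschitz_left_limit (g : R -> R) (a T K : R) :
  a < T -> 0 <= K ->
  (forall s t, a <= s <= t -> t < T -> Rabs (g t - g s) <= K * (t - s)) ->
  exists l, filterlim g (at_left T) (locally l).
Proof.
  intros HaT HK HL.
  apply (proj1 (filterlim_locally_cauchy (F := at_left T) g)).
  intros eps.
  assert (Hd : 0 < Rmin (T - a) (eps / (K + 1))).
  { apply Rmin_pos; [lra |].
    apply Rdiv_lt_0_compat; [apply cond_pos | lra]. }
  exists (fun s => T - Rmin (T - a) (eps / (K + 1)) < s < T).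
  split.
  { exists (mkposreal _ Hd); intros s Hs HsT.
    change (Rabs (s - T) < Rmin (T - a) (eps / (K + 1))) in Hs.
    apply Rabs_def2 in Hs; lra. }
  assert (Hl := Rmin_l (T - a) (eps / (K + 1))).
  assert (Hr := Rmin_r (T - a) (eps / (K + 1))).
  assert (E : (K + 1) * (eps / (K + 1)) = eps) by (field; lra).
  assert (Hlt : forall s t, s <= t ->
    T - Rmin (T - a) (eps / (K + 1)) < s -> t < T -> Rabs (g t - g s) < eps).
  { intros s t Hst Hs Ht.
    apply Rle_lt_trans with (1 := HL s t ltac:(lra) Ht).
    apply Rle_lt_trans with ((K + 1) * (t - s)).
    - apply Rmult_le_compat_r; lra.
    - rewrite <- E; apply Rmult_lt_compat_l; lra. }
  intros s t Hs Ht; change (Rabs (g t - g s) < eps).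
  destruct (Rle_dec s t) as [Hst | Hst].
  - apply Hlt; lra.
  - rewrite Rabs_minus_sym; apply Hlt; lra.
Qed.

(** A derivative that converges at an endpoint makes the function differentiable
    there: by the mean value theorem [fun t => g t - t * l] has arbitrarily small
    Lipschitz constants near [T]. *)
Lemma left_derivative_of_limit (g dg : R -> R) (a T gT l : R) :
  a < T -> (forall t, a <= t < T -> is_derive g t (dg t)) ->
  filterlim g (at_left T) (locally gT) ->
  filterlim dg (at_left T) (locally l) ->
  forall eps, 0 < eps -> exists d, 0 < d /\ forall s, T - d < s < T ->
    Rabs (g s - gT - (s - T) * l) <= eps * Rabs (s - T).
Proof.
  intros HaT Hder Hg Hdg eps Heps.
  destruct (left_limit_eps dg T l Hdg eps Heps) as [d1 [Hd1 H1]].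
  exists (Rmin d1 (T - a)); split; [apply Rmin_pos; lra |].
  intros s Hs.
  assert (Hl := Rmin_l d1 (T - a)); assert (Hr := Rmin_r d1 (T - a)).
  rewrite (Rabs_left (s - T)) by lra.
  apply le_epsilon; intros e He.
  (* Compare [s] with a time [r] so close to [T] that replacing [g r] by [gT]
     and [r] by [T] costs at most [e]. *)
  set (e' := e / (2 * (Rabs l + 1))).
  assert (Hl0 := Rabs_pos l).
  assert (He' : 0 < e') by (apply Rdiv_lt_0_compat; lra).
  destruct (left_limit_eps g T gT Hg (e / 2) ltac:(lra)) as [d2 [Hd2 H2]].
  set (r := Rmax s (Rmax (T - d2 / 2) (T - e'))).
  assert (Hr1 : s <= r) by apply Rmax_l.
  assert (Hr2 : T - d2 / 2 <= r).
  { apply Rle_trans with (2 := Rmax_r _ _), Rmax_l. }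
  assert (Hr3 : T - e' <= r).
  { apply Rle_trans with (2 := Rmax_r _ _), Rmax_r. }
  assert (Hr4 : r < T) by (repeat apply Rmax_lub_lt; lra).
  destruct (mean_value g dg s r Hr1) as [c [Hc Ec]].
  { intros c Hc; apply Hder; lra. }
  assert (A1 : Rabs (g r - g s - (r - s) * l) <= eps * (T - s)).
  { rewrite Ec; replace (dg c * (r - s) - (r - s) * l)
      with ((dg c - l) * (r - s)) by ring.
    rewrite Rabs_mult, (Rabs_pos_eq (r - s)) by lra.
    apply Rmult_le_compat; [apply Rabs_pos | lra | | lra].
    apply Rlt_le, H1; lra. }
  assert (A2 : Rabs (g r - gT) < e / 2) by (apply H2; lra).
  assert (A3 : Rabs ((T - r) * l) <= e / 2).
  { rewrite Rabs_mult, (Rabs_pos_eq (T - r)) by lra.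
    apply Rle_trans with (e' * (Rabs l + 1)).
    - apply Rmult_le_compat; lra.
    - unfold e'; right; field; lra. }
  replace (g s - gT - (s - T) * l)
    with (- (g r - g s - (r - s) * l) + ((g r - gT) + (T - r) * l)) by ring.
  eapply Rle_trans; [apply Rabs_triang |]; rewrite Rabs_Ropp.
  pose proof (Rabs_triang (g r - gT) ((T - r) * l)); lra.
Qed.

Definition glue (T : R) (g z : R -> R) (t : R) : R :=
  if Rlt_dec t T then g t else z t.

Lemma glue_left (T : R) (g z : R -> R) (t : R) : t < T -> glue T g z t = g t.
Proof. intros H; unfold glue; destruct Rlt_dec; [reflexivity | lra]. Qed.

Lemma glue_right (T : R) (g z : R -> R) (t : R) : T <= t -> glue T g z t = z t.
Proof. intros H; unfold glue; destruct Rlt_dec; [lra | reflexivity]. Qed.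

Lemma is_derive_within_glue (g dg z dz : R -> R) (t0 T T' : R) :
  t0 < T ->
  (forall t, Ico t0 T t -> is_derive_within (Ico t0 T) g t (dg t)) ->
  (forall t, T <= t < T' -> is_derive z t (dz t)) ->
  filterlim g (at_left T) (locally (z T)) ->
  filterlim dg (at_left T) (locally (dz T)) ->
  forall t, Ico t0 T' t ->
    is_derive_within (Ico t0 T') (glue T g z) t (glue T dg dz t).
Proof.
  intros HT0 Hg Hz Hlim Hdlim t Ht.
  apply is_derive_within_iff; [exact Ht |].
  intros eps Heps; destruct Ht as [Ht0 HtT']; simpl in HtT'.
  destruct (Rlt_dec t T) as [HtT | HtT].
  - assert (HI : Ico t0 T t) by (split; assumption).
    destruct (proj1 (is_derive_within_iff _ _ _ _ HI) (Hg t HI) eps Heps)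
      as [d [Hd0 Hd]].
    exists (Rmin d (T - t)); split; [apply Rmin_pos; lra |].
    intros s [Hs0 _] Hst.
    assert (Hl := Rmin_l d (T - t)); assert (Hr := Rmin_r d (T - t)).
    assert (HsT : s < T) by (apply Rabs_def2 in Hst; lra).
    rewrite !glue_left by assumption.
    apply Hd; [split; assumption | lra].
  - rewrite !(glue_right T _ _ t) by lra.
    destruct (is_derive_eps z t (dz t) (Hz t ltac:(lra)) eps Heps)
      as [d [Hd0 Hd]].
    destruct (Rlt_dec T t) as [HTt | HTt].
    + exists (Rmin d (t - T)); split; [apply Rmin_pos; lra |].
      intros s _ Hst.
      assert (Hl := Rmin_l d (t - T)); assert (Hr := Rmin_r d (t - T)).
      rewrite glue_right by (apply Rabs_def2 in Hst; lra).
      apply Hd; lra.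
    (* At the junction the two one-sided derivatives agree. *)
    + assert (t = T) by lra; subst t.
      destruct (left_derivative_of_limit g dg ((t0 + T) / 2) T (z T) (dz T))
        with (eps := eps) as [d' [Hd'0 Hd']]; try assumption; [lra | |].
      { intros r Hr; apply (is_derive_within_interior (Ico t0 T)).
        - apply Ico_interior; simpl; lra.
        - apply Hg; split; simpl; lra. }
      exists (Rmin d d'); split; [apply Rmin_pos; assumption |].
      intros s _ Hst.
      assert (Hl := Rmin_l d d'); assert (Hr := Rmin_r d d').
      destruct (Rlt_dec s T) as [HsT | HsT].
      * rewrite glue_left by assumption.
        apply Hd'; apply Rabs_def2 in Hst; lra.
      * rewrite glue_right by lra; apply Hd; lra.
Qed.

(** Here [v] stands for the unknown [x t] itself, not for [x t / t]. *)
Lemma acceleration_continuous (f : R -> R -> R) (t v : R) :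
  jointly_continuous f -> t <> 0 ->
  continuous (fun q : R * R => - f (fst q) (snd q / fst q)) (t, v).
Proof.
  intros Hf Ht.
  apply @continuous_opp.
  apply (continuous_comp_2 (fun q : R * R => fst q)
           (fun q : R * R => snd q / fst q) f); [apply continuous_fst | | apply Hf].
  apply @continuous_mult; [apply continuous_snd |].
  apply (continuous_comp fst Rinv); [apply continuous_fst |].
  apply continuous_Rinv; exact Ht.
Qed.

Lemma solution_on_of_derivatives (f : R -> R -> R) (t0 : R) (T : Rbar)
  (x dx : R -> R) :
  jointly_continuous f -> 0 < t0 ->
  (forall t, Ico t0 T t -> is_derive_within (Ico t0 T) x t (dx t)) ->
  (forall t, Ico t0 T t -> is_derive_within (Ico t0 T) dx t (- f t (x t / t))) ->
  solution_on f t0 T x.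
Proof.
  intros Hf Ht0 Hx Hdx; exists dx, (fun t => - f t (x t / t)).
  split; [exact Hx |]; split; [exact Hdx |]; split; [| intros; ring].
  intros t Ht.
  apply (filterlim_continuous_2 (fun s => s) x (fun s v => - f s (v / s))).
  - intros P HP; unfold filtermap, within.
    apply filter_imp with (2 := HP); auto.
  - exact (is_derive_within_continuous _ _ _ _ Ht (Hx t Ht)).
  - apply acceleration_continuous; [exact Hf | destruct Ht; lra].
Qed.

(** A finite limit of [x] at [T] gives limits of [x''], hence of [x'], and these
    are the initial data of a Peano solution [z] to the right of [T].  The glued
    function is twice differentiable at [T] because [x'] and [x''] have the same
    limits from both sides. *)
Lemma solution_extends (f : R -> R -> R) (t0 T : R) (x : R -> R) (xT : R) :
  jointly_continuous f -> 0 < t0 -> t0 < T ->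
  solution_on f t0 T x ->
  filterlim x (at_left T) (locally xT) ->
  exists (T' : Rbar) (y : R -> R),
    Rbar_lt T T' /\ solution_on f t0 T' y /\ forall t, Ico t0 T t -> y t = x t.
Proof.
  intros Hf Ht0 HT [dx [ddx [Hx [Hdx [_ Heq]]]]] HxT.
  assert (Hid : filterlim (fun t : R => t) (at_left T) (locally T)).
  { intros P HP; unfold filtermap, at_left, within.
    apply filter_imp with (2 := HP); auto. }
  assert (Hacc : filterlim ddx (at_left T) (locally (- f T (xT / T)))).
  { apply filterlim_ext_loc with (fun t => - f t (x t / t)).
    - assert (Hd : 0 < T - t0) by lra.
      exists (mkposreal _ Hd); intros s Hs HsT.
      change (Rabs (s - T) < T - t0) in Hs; apply Rabs_def2 in Hs.
      assert (Hs' : Ico t0 T s) by (split; simpl; lra).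
      specialize (Heq s Hs'); lra.
    - apply (filterlim_continuous_2 (fun s => s) x (fun s v => - f s (v / s)));
        [exact Hid | exact HxT |].
      apply acceleration_continuous; [exact Hf | lra]. }
  assert (Hvel : exists p, filterlim dx (at_left T) (locally p)).
  { destruct (left_limit_eps ddx T _ Hacc 1 Rlt_0_1) as [d [Hd0 Hd]].
    set (K := Rabs (- f T (xT / T)) + 1).
    assert (Ha := Rmax_l ((t0 + T) / 2) (T - d / 2)).
    assert (Hb := Rmax_r ((t0 + T) / 2) (T - d / 2)).
    apply lipschitz_left_limit with (Rmax ((t0 + T) / 2) (T - d / 2)) K.
    - apply Rmax_lub_lt; lra.
    - unfold K; generalize (Rabs_pos (- f T (xT / T))); lra.
    - intros s t Hs Ht.
      destruct (mean_value dx ddx s t) as [c [Hc Ec]]; [lra | |].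
      { intros r Hr; apply (is_derive_within_interior (Ico t0 T)).
        - apply Ico_interior; simpl; lra.
        - apply Hdx; split; simpl; lra. }
      rewrite Ec, Rabs_mult, (Rabs_pos_eq (t - s)) by lra.
      apply Rmult_le_compat_r; [lra |].
      specialize (Hd c ltac:(lra)).
      replace (ddx c) with (- f T (xT / T) + (ddx c - - f T (xT / T))) by ring.
      eapply Rle_trans; [apply Rabs_triang | unfold K; lra]. }
  destruct Hvel as [p Hp].
  destruct (peano_local (fun t v => - f t (v / t)) T xT p)
    as [d [z [dz [Hd [Ez [Edz [Hz Hdz]]]]]]].
  { intros t v Ht; apply acceleration_continuous; [exact Hf | lra]. }
  exists (T + d), (glue T x z); split; [simpl; lra |].
  split; [| intros t [_ Ht]; apply glue_left; exact Ht].
  apply (solution_on_of_derivatives f t0 (T + d) _ (glue T dx dz) Hf Ht0).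
  - apply is_derive_within_glue; try assumption.
    + intros t _; apply Hz.
    + rewrite Ez; exact HxT.
    + rewrite Edz; exact Hp.
  - intros t Ht.
    replace (- f t (glue T x z t / t))
      with (glue T ddx (fun s => - f s (z s / s)) t).
    + revert t Ht; apply is_derive_within_glue; try assumption.
      * rewrite Edz; exact Hp.
      * rewrite Ez; exact Hacc.
    + unfold glue; destruct Rlt_dec as [HtT | HtT]; [| reflexivity].
      assert (Ht' : Ico t0 T t) by (destruct Ht; split; assumption).
      specialize (Heq t Ht'); lra.
Qed.

Lemma solution_on_ext (f g : R -> R -> R) (t0 : R) (T : Rbar) (x : R -> R) :
  (forall t v, t0 <= t -> f t v = g t v) ->
  solution_on f t0 T x -> solution_on g t0 T x.
Proof.
  intros Efg [dx [ddx [H1 [H2 [H3 H4]]]]]; exists dx, ddx.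
  do 3 (split; [assumption |]).
  intros t Ht; rewrite <- Efg by apply Ht; apply H4, Ht.
Qed.

Lemma maximal_solution_ext (f g : R -> R -> R) (t0 : R) (T : Rbar) (x : R -> R) :
  (forall t v, t0 <= t -> f t v = g t v) ->
  maximal_solution f t0 T x -> maximal_solution g t0 T x.
Proof.
  intros Efg [HT [Hsol Hmax]]; split; [exact HT | split].
  - exact (solution_on_ext f g t0 T x Efg Hsol).
  - intros [T' [y [HT' [Hy Hyx]]]]; apply Hmax; exists T', y.
    split; [exact HT' | split; [| exact Hyx]].
    apply (solution_on_ext g f); [| exact Hy].
    intros t v Ht; symmetry; apply Efg, Ht.
Qed.

(** * The energy *)

(** A substitute for a nonpositive derivative, when only differences over
    intervals around each point can be estimated: the supremum of the points
    reached from [a] with slope at most [eps] must be [b]. *)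
Lemma straddle_nonincreasing (E : R -> R) (a b : R) :
  a <= b ->
  (forall t eps, a <= t <= b -> 0 < eps -> exists d, 0 < d /\
     forall r s, a <= r <= t -> t <= s <= b -> t - d < r -> s < t + d ->
       E s - E r <= eps * (s - r)) ->
  E b <= E a.
Proof.
  intros Hab HE.
  assert (Heps : forall eps, 0 < eps -> E b - E a <= eps * (b - a)).
  { intros eps Hpos.
    set (S := fun c => a <= c <= b /\ E c - E a <= eps * (c - a)).
    destruct (completeness S) as [m [Hub Hlub]].
    { exists b; intros c [Hc _]; lra. }
    { exists a; split; [lra |]; right; ring. }
    assert (Ham : a <= m) by (apply Hub; split; [lra | right; ring]).
    assert (Hmb : m <= b) by (apply Hlub; intros c [Hc _]; lra).
    destruct (HE m eps (conj Ham Hmb) Hpos) as [d [Hd Hstr]].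
    destruct (classic (exists c, S c /\ m - d < c)) as [[c [Hc Hcm]] | Hno].
    - assert (Hc' := Hub c Hc); destruct Hc as [Hc1 Hc2].
      set (s := Rmin b (m + d / 2)).
      assert (Hs1 : s <= b) by apply Rmin_l.
      assert (Hs2 : s <= m + d / 2) by apply Rmin_r.
      assert (Hs3 : m <= s) by (apply Rmin_glb; lra).
      specialize (Hstr c s ltac:(lra) ltac:(lra) Hcm ltac:(lra)).
      assert (HS : S s).
      { split; [lra |]. replace (eps * (s - a))
          with (eps * (s - c) + eps * (c - a)) by ring; lra. }
      assert (Hsm := Hub s HS).
      assert (Es : s = b).
      { unfold s, Rmin in *; destruct Rle_dec; lra. }
      rewrite Es in HS; exact (proj2 HS).
    - exfalso.
      assert (Hm : m <= m - d); [| lra].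
      apply Hlub; intros c Hc; apply Rnot_lt_le; intros Hlt.
      apply Hno; exists c; split; assumption. }
  apply le_epsilon; intros eps Hpos.
  assert (H1 : 0 < eps / (b - a + 1)) by (apply Rdiv_lt_0_compat; lra).
  specialize (Heps _ H1).
  assert (H2 : eps / (b - a + 1) * (b - a) <= eps).
  { apply Rle_trans with (eps / (b - a + 1) * (b - a + 1)).
    - apply Rmult_le_compat_l; lra.
    - right; field; lra. }
  lra.
Qed.

(** Multiplying by [s] reverses the comparison for negative [s], which matches
    the reversed orientation of the integral when [w < 0]. *)
Lemma RInt_le_outward (k1 k2 : R -> R) (w : R) :
  (forall s, continuous k1 s) -> (forall s, continuous k2 s) ->
  (forall s, s * k1 s <= s * k2 s) -> RInt k1 0 w <= RInt k2 0 w.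
Proof.
  intros H1 H2 Hle.
  destruct (Rle_dec 0 w) as [Hw | Hw].
  - apply RInt_le; [exact Hw | apply continuous_ex_RInt, H1 |
      apply continuous_ex_RInt, H2 |].
    intros s Hs; apply Rmult_le_reg_l with s; [lra | apply Hle].
  - rewrite <- (opp_RInt_swap k1 w 0), <- (opp_RInt_swap k2 w 0)
      by (apply continuous_ex_RInt; assumption).
    apply Ropp_le_contravar, RInt_le; [lra | apply continuous_ex_RInt, H2 |
      apply continuous_ex_RInt, H1 |].
    intros s Hs; specialize (Hle s).
    apply Rmult_le_reg_l with (- s); [lra |]; lra.
Qed.

Definition potential (f : R -> R -> R) (t w : R) : R :=
  RInt (fun r => t ^ 3 * f t r) 0 w.

Lemma section_continuous (f : R -> R -> R) (t r : R) :
  jointly_continuous f -> continuous (fun w => t ^ 3 * f t w) r.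
Proof.
  intros Hf; apply (continuous_scal_r (t ^ 3) (f t)).
  apply (jointly_continuous_comp f (fun _ => t) (fun w => w)); [exact Hf | |].
  - apply continuous_const.
  - apply continuous_id.
Qed.

Lemma potential_nonneg (f : R -> R -> R) (t w : R) :
  jointly_continuous f -> 0 <= t -> (forall r, 0 <= r * f t r) ->
  0 <= potential f t w.
Proof.
  intros Hf Ht Hsign; unfold potential.
  replace 0 with (RInt (fun _ => 0) 0 w) at 1.
  - apply RInt_le_outward; [intros; apply continuous_const |
      intros; apply section_continuous, Hf |].
    intros s; rewrite Rmult_0_r.
    replace (s * (t ^ 3 * f t s)) with (t ^ 3 * (s * f t s)) by ring.
    apply Rmult_le_pos; [apply pow_le, Ht | apply Hsign].
  - rewrite RInt_const; apply Rmult_0_r.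
Qed.

(** Between times [r <= s], replacing [potential f r (v r)] by
    [potential f s (v r)] only increases the difference of energies, since the
    potential at a fixed position does not increase in time.  With the
    time in the potential frozen at [s], the mean value theorem gives a slope
    [W c / c ^ 2 * (s ^ 3 * f s (v c) - c ^ 3 * f c (v c))], and this is small
    when [c] and [s] are close. *)
Lemma energy_nonincreasing (f : R -> R -> R) (v W : R -> R) (a b : R) :
  jointly_continuous f -> 0 < a -> a <= b ->
  (forall r s w, a <= r <= s -> w * (s ^ 3 * f s w) <= w * (r ^ 3 * f r w)) ->
  (forall t, a <= t <= b -> is_derive v t (W t / t ^ 2)) ->
  (forall t, a <= t <= b -> is_derive W t (- (t * f t (v t)))) ->
  W b ^ 2 / 2 + potential f b (v b) <= W a ^ 2 / 2 + potential f a (v a).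
Proof.
  intros Hf Ha Hab Hmono Hv HW.
  apply (straddle_nonincreasing (fun t => W t ^ 2 / 2 + potential f t (v t)));
    [exact Hab |].
  intros t eps Ht Heps.
  set (rate := fun c s : R =>
         W c / c ^ 2 * (s ^ 3 * f s (v c) - c ^ 3 * f c (v c))).
  assert (Hrate : continuous (fun q : R * R => rate (fst q) (snd q)) (t, t)).
  { assert (Hfst := continuous_fst t t); assert (Hsnd := continuous_snd t t).
    assert (Hvc : continuous (fun q : R * R => v (fst q)) (t, t)).
    { apply (continuous_comp fst v); [exact Hfst |].
      exact (is_derive_continuous_at _ _ _ (Hv t Ht)). }
    assert (Hpow : forall g : R * R -> R, continuous g (t, t) ->
              continuous (fun q => g q ^ 3) (t, t)).
    { intros g Hg; simpl; apply @continuous_mult; [exact Hg |].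
      apply @continuous_mult; [exact Hg |].
      apply @continuous_mult; [exact Hg | apply continuous_const]. }
    assert (Hfc : forall g : R * R -> R, continuous g (t, t) ->
              continuous (fun q => g q ^ 3 * f (g q) (v (fst q))) (t, t)).
    { intros g Hg; apply @continuous_mult; [apply Hpow, Hg |].
      apply (continuous_comp_2 g (fun q : R * R => v (fst q)) f);
        [exact Hg | exact Hvc | apply Hf]. }
    assert (Hslope : is_derive (fun c => W c / c ^ 2) t
              (- (t * f t (v t)) / t ^ 2 - 2 * W t / t ^ 3)).
    { assert (H := HW t Ht); auto_derive.
      - split; [exists (- (t * f t (v t))); exact H |].
        split; [apply Rgt_not_eq; nra | exact I].
      - rewrite (is_derive_unique (fun c : R => W c) _ _ H); field; lra. }
    unfold rate; apply @continuous_mult.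
    - apply (continuous_comp fst (fun c => W c / c ^ 2)); [exact Hfst |].
      exact (is_derive_continuous_at _ _ _ Hslope).
    - apply @continuous_minus; apply Hfc; assumption. }
  destruct (proj2 (continuity_2d_pt_filterlim rate t t) Hrate
              (mkposreal eps Heps)) as [d Hd].
  simpl in Hd; assert (Hd0 := cond_pos d).
  assert (Ezero : rate t t = 0) by (unfold rate; ring).
  exists d; split; [exact Hd0 |].
  intros r s Hr Hs Hrd Hsd.
  destruct (mean_value (fun c => W c ^ 2 / 2 + potential f s (v c))
              (fun c => rate c s) r s) as [c [Hc Ec]]; [lra | |].
  - intros c Hc; unfold rate, potential.
    assert (HWc := HW c ltac:(lra)); assert (Hvc := Hv c ltac:(lra)).
    replace (W c / c ^ 2 * (s ^ 3 * f s (v c) - c ^ 3 * f c (v c)))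
      with (W c * (- (c * f c (v c))) + W c / c ^ 2 * (s ^ 3 * f s (v c)))
      by (field; lra).
    apply @is_derive_plus.
    + auto_derive; [exists (- (c * f c (v c))); exact HWc |].
      rewrite (is_derive_unique (fun c : R => W c) _ _ HWc); field.
    + apply (is_derive_comp (fun w => RInt (fun r => s ^ 3 * f s r) 0 w) v);
        [| exact Hvc].
      apply (is_derive_primitive (fun r => s ^ 3 * f s r)).
      intros w; apply section_continuous, Hf.
  - assert (Hpot : potential f s (v r) <= potential f r (v r)).
    { apply RInt_le_outward; [intros; apply section_continuous, Hf |
        intros; apply section_continuous, Hf |].
      intros w; apply Hmono; lra. }
    assert (Hsmall : rate c s <= eps).
    { apply Rle_trans with (1 := Rle_abs _).
      rewrite <- (Rminus_0_r (rate c s)), <- Ezero.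
      apply Rlt_le, Hd; apply Rabs_def1; lra. }
    apply (Rmult_le_compat_r (s - r)) in Hsmall; lra.
Qed.

(** The first-order system satisfied by [v = x / t] and [W = t * x' - x]. *)
Definition phase_trajectory (f : R -> R -> R) (a : R) (T : Rbar) (v W : R -> R)
  : Prop :=
  forall t, a <= t -> Rbar_lt t T ->
    is_derive v t (W t / t ^ 2) /\ is_derive W t (- (t * f t (v t))).

(** The force points towards the origin, and its intensity
    [t ^ 3 * |f t v|] does not increase in time. *)
Definition restoring_decay (f : R -> R -> R) (a : R) : Prop :=
  (forall t v, a <= t -> 0 <= v * f t v) /\
  (forall r s v, a <= r <= s -> v * (s ^ 3 * f s v) <= v * (r ^ 3 * f r v)).

Lemma solution_phase_trajectory (f : R -> R -> R) (t0 a : R) (T : Rbar)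
  (x : R -> R) :
  0 < t0 < a -> solution_on f t0 T x ->
  exists W, phase_trajectory f a T (fun t => x t / t) W.
Proof.
  intros Ha [dx [ddx [Hx [Hdx [_ Heq]]]]].
  exists (fun t => t * dx t - x t); intros t Hat HT.
  assert (Ht : Ico t0 T t) by (split; [lra | exact HT]).
  assert (Hint : locally t (Ico t0 T)).
  { apply Ico_interior; [lra | exact HT]. }
  assert (H1 := is_derive_within_interior _ _ _ _ Hint (Hx t Ht)).
  assert (H2 := is_derive_within_interior _ _ _ _ Hint (Hdx t Ht)).
  specialize (Heq t Ht).
  split.
  - auto_derive; [split; [exists (dx t); exact H1 | lra] |].
    rewrite (is_derive_unique (fun s : R => x s) _ _ H1); field; lra.
  - auto_derive.
    + split; [exists (ddx t); exact H2 |]; split; [exists (dx t); exact H1 | exact I].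
    + rewrite (is_derive_unique (fun s : R => x s) _ _ H1).
      rewrite (is_derive_unique (fun s : R => dx s) _ _ H2).
      replace (ddx t) with (- f t (x t / t)) by lra; ring.
Qed.

Lemma momentum_bounded (f : R -> R -> R) (a : R) (T : Rbar) (v W : R -> R) :
  jointly_continuous f -> 0 < a -> restoring_decay f a ->
  phase_trajectory f a T v W ->
  exists K, 0 <= K /\ forall t, a <= t -> Rbar_lt t T -> Rabs (W t) <= K.
Proof.
  intros Hf Ha [Hsign Hmono] Hphase.
  assert (Hpot : forall t w, a <= t -> 0 <= potential f t w).
  { intros t w Ht; apply potential_nonneg; [exact Hf | lra |].
    intros r; apply Hsign, Ht. }
  set (E := W a ^ 2 / 2 + potential f a (v a)).
  assert (HE : 0 <= E).
  { unfold E; generalize (Hpot a (v a) (Rle_refl a)) (pow2_ge_0 (W a)); lra. }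
  (* [|W| <= W ^ 2 + 1 <= 2 * E + 1]. *)
  exists (2 * E + 1); split; [lra |].
  intros t Hat HT.
  assert (H : W t ^ 2 / 2 + potential f t (v t) <= E).
  { apply energy_nonincreasing; try assumption; intros s Hs; apply Hphase;
      try lra; apply Rbar_le_lt_trans with (Finite t); simpl; try exact HT; apply Hs. }
  assert (Hp := Hpot t (v t) Hat).
  apply Rabs_le; nra.
Qed.

(** * Limits of position and momentum *)

(** [K / t] has derivative [- K / t ^ 2], so both [v + K / t] and [- v + K / t]
    are nonincreasing. *)
Lemma position_cauchy (v W : R -> R) (a b K : R) :
  0 < a -> a <= b ->
  (forall t, a <= t <= b -> is_derive v t (W t / t ^ 2)) ->
  (forall t, a <= t <= b -> Rabs (W t) <= K) ->
  Rabs (v b - v a) <= K * (/ a - / b).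
Proof.
  intros Ha Hab Hv HW.
  assert (Hbound : forall s, s = 1 \/ s = -1 ->
    s * (v b - v a) <= K * (/ a - / b)).
  { intros s Hs.
    destruct (mean_value (fun t => s * v t + K / t)
                (fun t => (s * W t - K) / t ^ 2) a b Hab) as [c [Hc Ec]].
    - intros t Ht; assert (H := Hv t Ht); auto_derive.
      + split; [exists (W t / t ^ 2); exact H | lra].
      + rewrite (is_derive_unique (fun s : R => v s) _ _ H); field; lra.
    - assert (HWc := HW c Hc); apply Rabs_le_between in HWc.
      assert (Hneg : (s * W c - K) / c ^ 2 <= 0).
      { apply Rmult_le_0_r; [destruct Hs; subst s; lra |].
        apply Rlt_le, Rinv_0_lt_compat, pow_lt; lra. }
      apply (Rmult_le_compat_r (b - a)) in Hneg; [| lra].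
      unfold Rdiv in *; lra. }
  apply Rabs_le; generalize (Hbound 1 (or_introl eq_refl))
    (Hbound (-1) (or_intror eq_refl)); lra.
Qed.

(** [x / t] is Lipschitz up to [T], as its derivative is [W / t ^ 2]. *)
Lemma bounded_momentum_left_limit (a T : R) (x W : R -> R) (K : R) :
  0 < a -> a < T -> 0 <= K ->
  (forall t, a <= t < T -> is_derive (fun s => x s / s) t (W t / t ^ 2)) ->
  (forall t, a <= t < T -> Rabs (W t) <= K) ->
  exists xT, filterlim x (at_left T) (locally xT).
Proof.
  intros Ha HT HK Hv HW.
  destruct (lipschitz_left_limit (fun s => x s / s) a T (K / a ^ 2)) as [l Hl];
    [exact HT | apply Rdiv_le_0_compat; [exact HK | apply pow_lt, Ha] | |].
  { intros s t Hs Ht.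
    eapply Rle_trans; [apply (position_cauchy (fun s => x s / s) W s t K) |];
      try lra; try (intros r Hr; apply Hv || apply HW; lra).
    replace (K / a ^ 2 * (t - s)) with (K * (t - s) * (/ a * / a)) by (field; lra).
    replace (K * (/ s - / t)) with (K * (t - s) * (/ s * / t)) by (field; lra).
    apply Rmult_le_compat_l; [apply Rmult_le_pos; lra |].
    apply Rmult_le_compat; try (apply Rlt_le, Rinv_0_lt_compat; lra);
      apply Rinv_le_contravar; lra. }
  exists (T * l).
  apply filterlim_ext_loc with (fun s => s * (x s / s)).
  { assert (Hd : 0 < T - a) by lra.
    exists (mkposreal _ Hd); intros s Hs HsT.
    change (Rabs (s - T) < T - a) in Hs; apply Rabs_def2 in Hs; field; lra. }
  apply (filterlim_continuous_2 (fun s => s) (fun s => x s / s) Rmult);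
    [| exact Hl |].
  - intros P HP; unfold filtermap, at_left, within.
    apply filter_imp with (2 := HP); auto.
  - apply @continuous_mult; [apply continuous_fst | apply continuous_snd].
Qed.

(** [position_cauchy] with its right endpoint sent to infinity. *)
Lemma position_tail (v W : R -> R) (a K L : R) :
  0 < a ->
  (forall t, a <= t -> is_derive v t (W t / t ^ 2)) ->
  (forall t, a <= t -> Rabs (W t) <= K) ->
  is_lim v p_infty L ->
  forall t, a <= t -> Rabs (v t - L) <= K / t.
Proof.
  intros Ha Hv HW HL t Ht.
  assert (HK : 0 <= K).
  { apply Rle_trans with (2 := HW a (Rle_refl a)), Rabs_pos. }
  apply le_epsilon; intros eps Heps.
  apply is_lim_spec in HL.
  destruct (HL (mkposreal eps Heps)) as [M HM]; simpl in HM.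
  set (s := Rmax t (M + 1)).
  assert (Hts : t <= s) by apply Rmax_l.
  assert (HMs : M + 1 <= s) by apply Rmax_r.
  specialize (HM s ltac:(lra)).
  assert (H : Rabs (v s - v t) <= K * (/ t - / s)).
  { apply position_cauchy with W; try lra; intros r Hr;
      [apply Hv | apply HW]; lra. }
  assert (H0 : 0 <= K * / s).
  { apply Rmult_le_pos; [exact HK | apply Rlt_le, Rinv_0_lt_compat; lra]. }
  replace (v t - L) with (- (v s - v t) + (v s - L)) by ring.
  eapply Rle_trans; [apply Rabs_triang |]; rewrite Rabs_Ropp.
  unfold Rdiv; lra.
Qed.

Lemma position_converges (v W : R -> R) (a K : R) :
  0 < a ->
  (forall t, a <= t -> is_derive v t (W t / t ^ 2)) ->
  (forall t, a <= t -> Rabs (W t) <= K) ->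
  exists L : R, is_lim v p_infty L.
Proof.
  intros Ha Hv HW.
  assert (HK : 0 <= K).
  { apply Rle_trans with (2 := HW a (Rle_refl a)), Rabs_pos. }
  destruct (proj1 (filterlim_locally_cauchy (F := Rbar_locally p_infty) v))
    as [L HL]; [| exists L; exact HL].
  intros eps; assert (Heps := cond_pos eps).
  set (M := Rmax a ((K + 1) / eps)).
  assert (HM1 : a <= M) by apply Rmax_l.
  assert (HM2 : (K + 1) / eps <= M) by apply Rmax_r.
  exists (fun t => M < t); split; [exists M; auto |].
  assert (Hlt : forall s t, M < s -> s <= t -> Rabs (v t - v s) < eps).
  { intros s t Hs Hst.
    apply Rle_lt_trans with (K * (/ s - / t)).
    - apply position_cauchy with W; try lra; intros r Hr;
        [apply Hv | apply HW]; lra.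
    - assert (H1 : 0 < / t) by (apply Rinv_0_lt_compat; lra).
      assert (H2 : 0 <= K * / t) by (apply Rmult_le_pos; lra).
      apply Rle_lt_trans with (K / s); [unfold Rdiv; lra |].
      apply Rmult_lt_reg_r with s; [lra |].
      replace (K / s * s) with K by (field; lra).
      apply Rlt_trans with (eps * ((K + 1) / eps)).
      + replace (eps * ((K + 1) / eps)) with (K + 1) by (field; lra); lra.
      + apply Rmult_lt_compat_l; lra. }
  intros s t Hs Ht; change (Rabs (v t - v s) < eps).
  destruct (Rle_dec s t) as [Hst | Hst].
  - apply Hlt; assumption.
  - rewrite Rabs_minus_sym; apply Hlt; [assumption | lra].
Qed.

Lemma nonincreasing_bounded_lim (g : R -> R) (A K : R) :
  (forall s t, A <= s <= t -> g t <= g s) ->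
  (forall t, A <= t -> - K <= g t) ->
  exists l : R, is_lim g p_infty l.
Proof.
  intros Hmono Hbd.
  set (S := fun y => exists t, A <= t /\ y = - g t).
  destruct (completeness S) as [m [Hub Hlub]].
  { exists K; intros y [t [Ht ->]]; specialize (Hbd t Ht); lra. }
  { exists (- g A), A; split; [lra | reflexivity]. }
  exists (- m); apply is_lim_spec; intros eps; assert (Heps := cond_pos eps).
  destruct (classic (exists t, A <= t /\ m - eps < - g t)) as [[t [Ht Hgt]] | Hno].
  - exists t; intros s Hs.
    assert (H1 := Hmono t s ltac:(lra)).
    assert (H2 : - g s <= m) by (apply Hub; exists s; split; [lra | reflexivity]).
    apply Rabs_def1; lra.
  - exfalso; assert (Hm : m <= m - eps); [| lra].
    apply Hlub; intros y [t [Ht ->]]; apply Rnot_lt_le; intros Hlt.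
    apply Hno; exists t; split; assumption.
Qed.

(** Once [v] has the sign of its nonzero limit [L], the force has that sign too,
    so [L * W] is nonincreasing; it is bounded, hence converges. *)
Lemma momentum_converges (f : R -> R -> R) (a L K : R) (v W : R -> R) :
  0 < a -> restoring_decay f a ->
  phase_trajectory f a p_infty v W ->
  is_lim v p_infty L -> L <> 0 ->
  (forall t, a <= t -> Rabs (W t) <= K) ->
  exists w : R, is_lim W p_infty w.
Proof.
  intros Ha [Hsign _] Hphase HL HL0 HK.
  apply is_lim_spec in HL.
  destruct (HL (mkposreal _ (Rabs_pos_lt _ HL0))) as [M HM]; simpl in HM.
  set (A := Rmax a (M + 1)).
  assert (HA1 : a <= A) by apply Rmax_l.
  assert (HA2 : M + 1 <= A) by apply Rmax_r.
  assert (Hmono : forall s t, A <= s <= t -> L * W t <= L * W s).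
  { intros s t Hst.
    destruct (mean_value W (fun r => - (r * f r (v r))) s t) as [c [Hc Ec]];
      [lra | |].
    - intros r Hr; apply Hphase; [lra | exact I].
    - assert (Hf : 0 <= L * f c (v c)).
      { assert (Hs := Hsign c (v c) ltac:(lra)).
        assert (Hv := HM c ltac:(lra)).
        assert (Hvc : 0 < L * v c).
        { unfold Rabs in Hv; repeat destruct Rcase_abs in Hv; nra. }
        destruct (Rtotal_order L 0) as [HLn | [HLn | HLn]]; nra. }
      assert (Hint : 0 <= c * (L * f c (v c)) * (t - s)).
      { apply Rmult_le_pos; [apply Rmult_le_pos |]; lra. }
      replace (L * W t) with (L * W s + L * (W t - W s)) by ring.
      rewrite Ec; lra. }
  destruct (nonincreasing_bounded_lim (fun t => L * W t) A (Rabs L * K) Hmono)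
    as [l Hl].
  { intros t Ht.
    assert (H : Rabs (L * W t) <= Rabs L * K).
    { rewrite Rabs_mult; apply Rmult_le_compat_l; [apply Rabs_pos |].
      apply HK; lra. }
    apply Rabs_le_between in H; lra. }
  exists (/ L * l).
  apply is_lim_ext with (fun t => / L * (L * W t)).
  { intros t; field; exact HL0. }
  exact (is_lim_scal_l _ (/ L) p_infty l Hl).
Qed.

(** [v + w / t] has derivative [(W - w) / t ^ 2], whose numerator tends to zero,
    so [position_tail] applies to it with arbitrarily small constants. *)
Lemma affine_asymptote (v W : R -> R) (a L w : R) :
  0 < a ->
  (forall t, a <= t -> is_derive v t (W t / t ^ 2)) ->
  is_lim v p_infty L -> is_lim W p_infty w ->
  is_lim (fun t => t * (v t - L)) p_infty (- w).
Proof.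
  intros Ha Hv HL Hw.
  apply is_lim_spec; intros eps; assert (Heps := cond_pos eps).
  apply is_lim_spec in Hw.
  destruct (Hw (mkposreal (eps / 2) ltac:(lra))) as [M HM]; simpl in HM.
  set (A := Rmax a (M + 1)).
  assert (HA1 : a <= A) by apply Rmax_l.
  assert (HA2 : M + 1 <= A) by apply Rmax_r.
  exists A; intros t Ht.
  assert (H : Rabs (v t + w / t - L) <= eps / 2 / t).
  { apply (position_tail (fun s => v s + w / s) (fun s => W s - w) A (eps / 2) L);
      [lra | | | | lra].
    - intros s Hs; assert (Hvs := Hv s ltac:(lra)); auto_derive.
      + split; [exists (W s / s ^ 2); exact Hvs | lra].
      + rewrite (is_derive_unique (fun s : R => v s) _ _ Hvs); field; lra.
    - intros s Hs; apply Rlt_le, HM; lra.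
    - replace (Finite L) with (Rbar_plus L (Rbar_mult w (Rbar_inv p_infty)))
        by (simpl; f_equal; ring).
      apply is_lim_plus'; [exact HL |].
      apply (is_lim_scal_l Rinv w p_infty 0).
      apply is_lim_inv with (l := p_infty); [apply is_lim_id | discriminate]. }
  replace (t * (v t - L) - - w) with (t * (v t + w / t - L)) by (field; lra).
  rewrite Rabs_mult, (Rabs_pos_eq t) by lra.
  apply (Rmult_le_compat_l t) in H; [| lra].
  replace (t * (eps / 2 / t)) with (eps / 2) in H by (field; lra).
  lra.
Qed.

Lemma is_lim_little_o (g h : R -> R) :
  (forall t, 0 < t -> h t <> 0) ->
  is_lim (fun t => g t / h t) p_infty 0 -> little_o_pinfty g h.
Proof.
  intros Hh Hlim eps; apply is_lim_spec in Hlim.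
  destruct (Hlim eps) as [M HM].
  exists (Rmax 0 M); intros t Ht.
  assert (H0 : 0 < t) by (apply Rle_lt_trans with (2 := Ht), Rmax_l).
  assert (HMt : M < t) by (apply Rle_lt_trans with (2 := Ht), Rmax_r).
  specialize (HM t HMt); rewrite Rminus_0_r in HM.
  change (Rabs (g t) <= eps * Rabs (h t)).
  replace (g t) with (g t / h t * h t) by (field; apply Hh, H0).
  rewrite Rabs_mult; apply Rmult_le_compat_r; [apply Rabs_pos | lra].
Qed.

(** * Maximal solutions *)

(** The argument runs on [[a, T)] with [t0 < a]: there all derivatives are
    two-sided, and only the behaviour near [T] matters. *)
Lemma maximal_solution_asymptotics (f : R -> R -> R) (t0 : R) (T : Rbar)
  (x : R -> R) :
  0 < t0 -> jointly_continuous f ->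
  (forall a, t0 < a -> restoring_decay f a) ->
  maximal_solution f t0 T x ->
  T = p_infty /\
  (little_o_pinfty x (fun t : R => t) \/
   exists x1 x2 : R, x1 <> 0 /\
     little_o_pinfty (fun t : R => x t - (x1 * t + x2)) (fun _ : R => 1)).
Proof.
  intros Ht0 Hf Hdecay [HT [Hsol Hmax]].
  assert (HTinf : T = p_infty).
  { destruct T as [T | |]; [exfalso | reflexivity | contradiction].
    simpl in HT; set (a := (t0 + T) / 2).
    assert (Ha : t0 < a < T) by (unfold a; lra).
    destruct (solution_phase_trajectory f t0 a T x) as [W HW];
      [lra | exact Hsol |].
    destruct (momentum_bounded f a T _ W Hf ltac:(lra) (Hdecay a ltac:(lra)) HW)
      as [K [HK0 HK]].
    destruct (bounded_momentum_left_limit a T x W K) as [xT HxT];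
      [lra | lra | exact HK0 | | |].
    - intros t Ht; apply HW; simpl; lra.
    - intros t Ht; apply HK; simpl; lra.
    - apply Hmax; apply (solution_extends f t0 T x xT); assumption. }
  subst T; split; [reflexivity |].
  set (a := t0 + 1).
  assert (Ha : t0 < a) by (unfold a; lra).
  destruct (solution_phase_trajectory f t0 a p_infty x) as [W HW];
    [lra | exact Hsol |].
  set (v := fun t => x t / t) in HW.
  destruct (momentum_bounded f a p_infty v W Hf ltac:(lra) (Hdecay a Ha) HW)
    as [K [_ HK]].
  assert (Hv : forall t, a <= t -> is_derive v t (W t / t ^ 2)).
  { intros t Ht; apply HW; [exact Ht | exact I]. }
  assert (HWK : forall t, a <= t -> Rabs (W t) <= K).
  { intros t Ht; apply HK; [exact Ht | exact I]. }
  destruct (position_converges v W a K ltac:(lra) Hv HWK) as [L HL].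
  destruct (Req_dec L 0) as [-> | HL0].
  - left; apply is_lim_little_o; [intros; lra | exact HL].
  - right.
    destruct (momentum_converges f a L K v W ltac:(lra) (Hdecay a Ha) HW HL HL0 HWK)
      as [w Hw].
    exists L, (- w); split; [exact HL0 |].
    apply is_lim_little_o; [intros; lra |].
    apply is_lim_ext_loc with (fun t => t * (v t - L) - - w).
    { exists 0; intros t Ht; unfold v; field; lra. }
    replace (Finite 0) with (Finite (- w - - w)) by (f_equal; ring).
    apply is_lim_minus'; [| apply is_lim_const].
    apply affine_asymptote with W a; try assumption; lra.
Qed.

(** A continuous extension of [f] to all times, so that no one-sided continuity
    at [t0] has to be carried along. *)
Definition frozen_before (t0 : R) (f : R -> R -> R) (t v : R) : R :=
  f (Rmax t0 t) v.

Lemma frozen_before_continuous (t0 : R) (f : R -> R -> R) :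
  continuous_on (fun p : R * R => t0 <= fst p)
    (fun p : R * R => f (fst p) (snd p)) ->
  jointly_continuous (frozen_before t0 f).
Proof.
  intros Hf [t v].
  assert (Hmax : continuous (Rmax t0) t).
  { apply lipschitz_continuous with 1; intros r s.
    unfold Rmax; repeat destruct Rle_dec; apply Rabs_le_between;
      pose proof (Rle_abs (r - s)); pose proof (Rle_abs (- (r - s)));
      rewrite Rabs_Ropp in *; lra. }
  apply (filterlim_comp _ _ _ (fun q : R * R => (Rmax t0 (fst q), snd q))
           (fun q : R * R => f (fst q) (snd q)) _
           (within (fun p : R * R => t0 <= fst p) (locally (Rmax t0 t, v))));
    [| apply (Hf (Rmax t0 t, v)), Rmax_l].
  intros P [d Hd].
  destruct (proj1 (filterlim_locally (Rmax t0) (Rmax t0 t)) Hmax d) as [e He].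
  assert (Hm : 0 < Rmin d e) by (apply Rmin_pos; apply cond_pos).
  exists (mkposreal _ Hm); intros [s w] [Hs Hw]; simpl in Hs, Hw.
  apply Hd; [split; simpl | apply Rmax_l].
  - apply He; exact (ball_le _ _ _ (Rmin_r d e) _ Hs).
  - exact (ball_le _ _ _ (Rmin_l d e) _ Hw).
Qed.

(** [t ^ 3 * f t v] has derivative [t ^ 2 * (3 * f t v + t * ft t v)] in [t]. *)
Lemma restoring_decay_of_partial (t0 a : R) (f ft : R -> R -> R) :
  0 < t0 < a ->
  (forall t v : R, t0 <= t ->
     is_derive_within (fun s : R => t0 <= s) (fun s : R => f s v) t (ft t v)) ->
  (forall t v : R, t0 <= t -> v <> 0 ->
     v * f t v >= 0 /\ v * (3 * f t v + t * ft t v) <= 0) ->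
  restoring_decay f a.
Proof.
  intros Ha Hft Hsign; split.
  - intros t v Ht; destruct (Req_dec v 0) as [-> | Hv]; [lra |].
    destruct (Hsign t v ltac:(lra) Hv); lra.
  - intros r s v Hrs; destruct (Req_dec v 0) as [-> | Hv]; [lra |].
    destruct (mean_value (fun t => v * (t ^ 3 * f t v))
                (fun t => t ^ 2 * (v * (3 * f t v + t * ft t v))) r s)
      as [c [Hc Ec]]; [lra | |].
    + intros t Ht.
      assert (Hd : is_derive (fun s => f s v) t (ft t v)).
      { apply (is_derive_within_interior (fun s => t0 <= s)).
        - apply filter_imp with (fun s => t0 < s); [intros; lra |].
          apply open_gt; lra.
        - apply Hft; lra. }
      auto_derive; [exists (ft t v); exact Hd |].
      rewrite (is_derive_unique (fun s : R => f s v) _ _ Hd); ring.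
    + destruct (Hsign c v ltac:(lra) Hv) as [_ Hneg].
      assert (Hc2 : 0 <= c ^ 2) by apply pow2_ge_0.
      assert (H : 0 <= c ^ 2 * - (v * (3 * f c v + c * ft c v)) * (s - r)).
      { apply Rmult_le_pos; [apply Rmult_le_pos |]; lra. }
      lra.
Qed.

Theorem theorem2 (t0 : R) (ht0 : 1 <= t0) (f ft : R -> R -> R)
  (hf : continuous_on (fun p : R * R => t0 <= fst p)
          (fun p : R * R => f (fst p) (snd p)))
  (hft : forall t v : R, t0 <= t ->
     is_derive_within (fun s : R => t0 <= s) (fun s : R => f s v) t (ft t v))
  (hft_cont : continuous_on (fun p : R * R => t0 <= fst p)
          (fun p : R * R => ft (fst p) (snd p)))
  (hsign : forall t v : R, t0 <= t -> v <> 0 ->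
     v * f t v >= 0 /\ v * (3 * f t v + t * ft t v) <= 0)
  (T : Rbar) (x : R -> R) (hx : maximal_solution f t0 T x) :
  T = p_infty /\
  (little_o_pinfty x (fun t : R => t) \/
   exists x1 x2 : R, x1 <> 0 /\
     little_o_pinfty (fun t : R => x t - (x1 * t + x2)) (fun _ : R => 1)).
Proof.
  assert (Eext : forall t v, t0 <= t -> f t v = frozen_before t0 f t v).
  { intros t v Ht; unfold frozen_before; rewrite Rmax_right by exact Ht.
    reflexivity. }
  apply (maximal_solution_asymptotics (frozen_before t0 f) t0 T x); [lra | | |].
  - apply frozen_before_continuous, hf.
  - intros a Ha.
    destruct (restoring_decay_of_partial t0 a f ft) as [H1 H2];
      [lra | exact hft | exact hsign |].
    split.
    + intros t v Ht; rewrite <- Eext by lra; apply H1, Ht.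
    + intros r s v Hrs; rewrite <- !Eext by lra; apply H2, Hrs.
  - exact (maximal_solution_ext _ _ t0 T x Eext hx).
Qed.
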